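(* Let $0<q<1$. For all integers $a,N\ge 0$ and all $i,j\in\{0,1,\dots,N\}$, $$\sum_{k=0}^N c_k\; {}_4\phi_3\!\left(\begin{matrix}q^{-i},\,q^{2a+i+1},\,q^{-k},\,q^{2a+k+1}\\ q^{a+1},\,q^{-N},\,q^{3a+N+2}\end{matrix};q,q\right)\,{}_4\phi_3\!\left(\begin{matrix}q^{-k},\,q^{2a+k+1},\,q^{-j},\,q^{2a+j+1}\\ q^{a+1},\,q^{-N},\,q^{3a+N+2}\end{matrix};q,q\right)$$ $$=(-1)^{i+j-N}q^{\binom i2+\binom j2-\binom N2}q^{(i+j-2N)(a+1)}\frac{(q^{2a+2};q)_N}{(q^{a+1};q)_N}\;{}_4\phi_3\!\left(\begin{matrix}q^{-i},\,q^{2a+i+1},\,q^{-j},\,q^{2a+j+1}\\ q^{a+1},\,q^{-N},\,q^{3a+N+2}\end{matrix};q,q\right),$$ where $$c_k=(-1)^kq^{-\binom k2}q^{-k(3a+2)}\,\frac{1-q^{2a+1+2k}}{1-q^{2a+1}}\,\frac{(q^{2a+1},q^{3a+N+2},q^{-N};q)_k}{(q,q^{-a-N},q^{2a+N+2};q)_k}.$$ Equivalently, in terms of the $q$-Racah polynomials $R_i(\mu(j))=R_i(\mu(j);q^a,q^a,q^{3a+N+1},q^{-a-N-1}|q)$, $$\sum_{k=0}^Nc_k\,R_i(\mu(k))R_j(\mu(k))=(-1)^{i+j-N}q^{\binom i2+\binom j2-\binom N2}q^{(i+j-2N)(a+1)}\frac{(q^{2a+2};q)_N}{(q^{a+1}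;q)_N}\,R_i(\mu(j)).$$
   Context: $(z;q)_0=1$, $(z;q)_k=\prod_{m=1}^k(1-zq^{m-1})$, $(z_1,\dots,z_r;q)_k=(z_1;q)_k\cdots(z_r;q)_k$. The basic hypergeometric series is $${}_4\phi_3\!\left(\begin{matrix}a_1,a_2,a_3,a_4\\ b_1,b_2,b_3\end{matrix};q,z\right)=\sum_{m\ge0}\frac{(a_1,a_2,a_3,a_4;q)_m}{(b_1,b_2,b_3;q)_m}\frac{z^m}{(q;q)_m}.$$ In all series here the numerator parameters include $q^{-x},q^{-y}$ with $x,y\in\{0,\dots,N\}$, and the series is understood as the terminating sum over $0\le m\le\min(x,y)$ (all denominators are then nonzero). The $q$-Racah polynomials are $$R_n(\mu(x);\alpha,\beta,\gamma,\delta|q)={}_4\phi_3\!\left(\begin{matrix}q^{-n},\alpha\beta q^{n+1},q^{-x},\gamma\delta q^{x+1}\\ \alpha q,\beta\delta q,\gamma q\end{matrix};q,q\right),\qquad n=0,1,\dots,N,$$ with $\mu(x)=q^{-x}+\gamma\delta q^{x+1}$ and one of $\alpha,\beta\delta,\gamma$ equal to $q^{-N-1}$; here, $\beta\delta=q^{-N-1}$. *)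

(* Defs.v *)
From mathcomp Require Import all_boot all_order all_algebra.

Set Implicit Arguments.
Unset Strict Implicit.
Unset Printing Implicit Defensive.

Import GRing.Theory Num.Theory.

Local Open Scope ring_scope.

(* (z; q)_k *)
Definition qpoch (F : fieldType) (z q : F) (k : nat) : F :=
  \prod_(1 <= m < k.+1) (1 - z * q ^+ m.-1).

(* (z_1, ..., z_r; q)_k *)
Definition qpochs (F : fieldType) (zs : seq F) (q : F) (k : nat) : F :=
  \prod_(z <- zs) qpoch z q k.

(* The terminating 4phi3 series, summed over 0 <= m <= M. When q^-x and q^-y
   are among the numerator parameters, M is min(x, y): beyond that index the
   numerators vanish, and the denominators may vanish too. *)
Definition phi43 (F : fieldType) (M : nat) (a1 a2 a3 a4 b1 b2 b3 q z : F) : F :=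
  \sum_(0 <= m < M.+1)
    qpochs [:: a1; a2; a3; a4] q m / qpochs [:: b1; b2; b3] q m
      * (z ^+ m / qpoch q q m).

(* The q-Racah polynomial R_n(mu(x); alpha, beta, gamma, delta | q), with
   mu(x) = q^-x + gamma delta q^(x+1), taken as a function of the node x. *)
Definition qRacah (F : fieldType) (n x : nat)
    (alpha beta gamma delta q : F) : F :=
  phi43 (minn n x)
    (q ^ (- n%:Z)) (alpha * beta * q ^+ n.+1)
    (q ^ (- x%:Z)) (gamma * delta * q ^+ x.+1)
    (alpha * q) (beta * delta * q) (gamma * q) q q.

(* The weight c_k; a and N are fixed. *)
Definition coef (F : fieldType) (q : F) (a N k : nat) : F :=
  (-1) ^+ k * q ^ (- ('C(k, 2))%:Z) * q ^ (- (k * (3 * a + 2))%N%:Z)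
  * ((1 - q ^+ (2 * a + 1 + 2 * k)) / (1 - q ^+ (2 * a + 1)))
  * (qpochs [:: q ^+ (2 * a + 1); q ^+ (3 * a + N + 2); q ^ (- N%:Z)] q k
     / qpochs [:: q; q ^ (- a%:Z - N%:Z); q ^+ (2 * a + N + 2)] q k).

(* Main.v *)
Require Import Defs.
From mathcomp Require Import all_boot all_order all_algebra ring zify.

Set Implicit Arguments.
Unset Strict Implicit.
Unset Printing Implicit Defensive.

Import Order.TTheory GRing.Theory Num.Theory.

Local Open Scope ring_scope.

(** Write p = q^a, n = q^N, al = p^2 q, and let P be the matrix of the values
    of the 4phi3 series, with rows and columns indexed by 0..N.  The series is a
    symmetric bilinear expression in the polynomials b_m(x) = (1/x, al x; q)_m
    at x = q^i and y = q^j, so the q-Racah recurrence holds in both indices: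
    A P = P Theta and hence Theta P = P A^T, where A is tridiagonal and Theta
    is the diagonal matrix of the numbers q^-i + al q^i ([kernel_recurrence]).

    The parameters are special in that al q is the square of p q.  For this
    reason conjugating A by the diagonal matrix S of the signs and powers of q
    on the right of the identity gives (lemma [mid_theta] is the key point)
      M = S A S^-1 = (q Theta A - A Theta) / (p (1 - q^2)) + constant.
    Then M P is a combination of Theta P Theta, A P A^T and P, so it is a
    symmetric matrix: M P = P M^T ([twisted_sym]).  On the other hand the
    weights c_k are the ones for which C = diag(c_k) satisfies M^T C = C A
    ([vwp_balance]).  Therefore F = P C P, the left side of the identity,
    satisfies
      F Theta = P C A P = P M^T C P = M P C P = M F,
    that is, G = S^-1 F S^-1 satisfies A G = G Theta, the equation of P
    ([conj_eigen]).  A solution of this equation is determined by its first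
    row ([tridiag_eigen0]); as G is symmetric and the first row of P consists
    of ones, G = G_00 P ([kernel_twist]).

    There remains G_00 = c_0 + ... + c_N, a limiting case of the terminating
    very-well-poised 6phi5 sum ([vwp_sum]), which follows by induction on N
    from a telescoping identity ([vwp_telescope]). *)

(** * q-shifted factorials *)

Lemma qpoch0 (F : fieldType) (z q : F) : qpoch z q 0 = 1.
Proof. by rewrite /qpoch big_geq. Qed.

Lemma qpochS (F : fieldType) (z q : F) k :
  qpoch z q k.+1 = qpoch z q k * (1 - z * q ^+ k).
Proof. by rewrite /qpoch big_nat_recr. Qed.

Lemma qpochSl (F : fieldType) (z q : F) k :
  qpoch z q k.+1 = (1 - z) * qpoch (z * q) q k.
Proof.
elim: k => [|k IHk]; first by rewrite qpochS !qpoch0 expr0 !mulr1 mul1r.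
by rewrite qpochS IHk [in RHS]qpochS exprS; ring.
Qed.

Lemma qpoch_neq0 (F : fieldType) (z q : F) k :
  (forall m, (m < k)%N -> 1 - z * q ^+ m != 0) -> qpoch z q k != 0.
Proof.
elim: k => [|k IHk] zq; first by rewrite qpoch0 oner_eq0.
by rewrite qpochS mulf_neq0 ?zq // IHk // => m mk; apply: zq; apply: ltnW.
Qed.

Lemma binS2 k : 'C(k.+1, 2) = ('C(k, 2) + k)%N.
Proof. by rewrite binS bin1. Qed.

Lemma qpoch_qV0 (F : fieldType) (q : F) N k : q != 0 -> (N < k)%N ->
  qpoch (q ^+ N)^-1 q k = 0.
Proof.
move=> q0; elim: k => // k IHk; rewrite ltnS leq_eqVlt => /orP[/eqP<-|Nk].
  by rewrite qpochS mulVf ?expf_neq0 // subrr mulr0.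
by rewrite qpochS IHk // mul0r.
Qed.

(** A factor 1 - 1/w equals - (1 - w)/w, and w runs through the same powers
    z q, ..., z q^N on both sides, in opposite orders. *)
Lemma qpoch_rev (F : fieldType) (z q : F) N : z != 0 -> q != 0 ->
  qpoch (z * q ^+ N)^-1 q N * (z ^+ N * (q ^+ 'C(N, 2) * q ^+ N))
  = (-1) ^+ N * qpoch (z * q) q N.
Proof.
move=> z0 q0; elim: N => [|N IHN]; first by rewrite !qpoch0 !expr0 !mulr1.
have n0 : q ^+ N != 0 by rewrite expf_neq0.
have eN : q ^+ N.+1 = q * q ^+ N by rewrite exprS.
have -> : qpoch (z * q ^+ N.+1)^-1 q N.+1
          = (1 - (z * q ^+ N.+1)^-1) * qpoch (z * q ^+ N)^-1 q N.
  rewrite qpochSl; congr (_ * qpoch _ _ _); rewrite eN; field.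
  by rewrite z0 q0 n0.
rewrite binS2 exprD [z ^+ N.+1]exprS [(-1) ^+ N.+1]exprS qpochS -mulrA.
transitivity ((1 - (z * q ^+ N.+1)^-1) * (z * q ^+ N.+1) *
  (qpoch (z * q ^+ N)^-1 q N * (z ^+ N * (q ^+ 'C(N, 2) * q ^+ N)))).
  by ring.
rewrite IHN eN; field; by rewrite z0 q0 n0.
Qed.

(** * Generic parameters *)

(** The factors that occur in denominators, or whose vanishing would let the
    three-term recurrence break off before its natural end. *)
Record generic (F : fieldType) (q p : F) : Prop := Generic {
  gen_q : q != 0;
  gen_p : p != 0;
  gen_q1 : forall m, 1 - q ^+ m.+1 != 0;
  gen_pN1 : forall m, 1 + p * q ^+ m != 0;
  gen_p1 : forall m, 1 - p * q ^+ m.+1 != 0;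
  gen_p2 : forall m, 1 - p ^+ 2 * q ^+ m.+1 != 0;
  gen_p3 : forall m, 1 - p ^+ 3 * q ^+ m.+1 != 0
}.

Lemma real_generic (R : realFieldType) (q p : R) :
  0 < q -> q < 1 -> 0 < p -> p <= 1 -> generic q p.
Proof.
move=> q0 q1 p0 p1.
have qX m : q ^+ m.+1 < 1 by rewrite exprn_ilt1 // ltW.
have ne r m : 0 <= r -> r <= 1 -> 1 - r * q ^+ m.+1 != 0.
  move=> r0 r1; rewrite subr_eq0 gt_eqF //; apply: le_lt_trans (qX m).
  by rewrite ler_piMl // exprn_ge0 // ltW.
have pX m : 0 <= p ^+ m <= 1 by rewrite exprn_ge0 ?exprn_ile1 // ltW.
split; rewrite ?gt_eqF // => m.
- by rewrite -[q ^+ _]mul1r ne.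
- by rewrite gt_eqF // addr_gt0 ?mulr_gt0 ?exprn_gt0.
- by rewrite ne // ltW.
- by case/andP: (pX 2%N) => ? ?; apply: ne.
- by case/andP: (pX 3%N) => ? ?; apply: ne.
Qed.

Lemma qX_neq0 (F : fieldType) (q p : F) m : generic q p -> q ^+ m != 0.
Proof. by move=> gen; rewrite expf_neq0 // (gen_q gen). Qed.

Lemma qX_sub (F : fieldType) (q p : F) i j : generic q p -> (i < j)%N ->
  1 - q ^+ i / q ^+ j != 0.
Proof.
move=> gen ij; have := gen_q1 gen (j - i).-1.
rewrite prednK ?subn_gt0 // -{2}(subnK (ltnW ij)) exprD.
have := qX_neq0 i gen; have := qX_neq0 (j - i) gen.
move: (q ^+ i) (q ^+ (j - i)) => x y y0 x0.
have -> : 1 - x / (y * x) = - (1 - y) / y by field; rewrite x0 y0.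
by move=> h; rewrite mulf_neq0 ?invr_eq0 ?oppr_eq0.
Qed.

Lemma pqX_sub (F : fieldType) (q p : F) i j : generic q p -> (i < j)%N ->
  1 - (p * q ^+ j)^-1 * q ^+ i != 0.
Proof.
move=> gen ij; have p0 := gen_p gen; have := gen_p1 gen (j - i).-1.
rewrite prednK ?subn_gt0 // -{2}(subnK (ltnW ij)) exprD.
have := qX_neq0 i gen; have := qX_neq0 (j - i) gen.
move: (q ^+ i) (q ^+ (j - i)) => x y y0 x0.
have -> : 1 - (p * (y * x))^-1 * x = - (1 - p * y) / (p * y).
  by field; rewrite x0 y0 p0.
by move=> h; rewrite mulf_neq0 ?invr_eq0 ?oppr_eq0 ?mulf_neq0.
Qed.

Lemma p2qX_neq0 (F : fieldType) (q p : F) m : generic q p ->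
  1 - p ^+ 2 * q * q ^+ m != 0.
Proof. by move=> gen; rewrite -mulrA -exprS (gen_p2 gen). Qed.

Lemma p3qX_neq0 (F : fieldType) (q p : F) N m : generic q p ->
  1 - p ^+ 3 * q ^+ 2 * q ^+ N * q ^+ m != 0.
Proof.
move=> gen; have -> : p ^+ 3 * q ^+ 2 * q ^+ N * q ^+ m
                      = p ^+ 3 * q ^+ (N + m).+2.
  by rewrite !exprS exprD; ring.
exact: (gen_p3 gen).
Qed.

(** * The recurrence on the basis polynomials *)

(** The q-quadratic lattice of the Askey-Wilson type polynomials: the nodes
    are [theta al (q ^+ i)], and both indices use the same lattice. *)
Definition theta (F : fieldType) (al x : F) : F := x^-1 + al * x.

Definition basis (F : fieldType) (q al : F) (m : nat) (x : F) : F :=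
  qpoch x^-1 q m * qpoch (al * x) q m.

Lemma basisS (F : fieldType) (q al : F) m (x : F) : x != 0 ->
  basis q al m.+1 x
  = basis q al m x * (1 + al * q ^+ m ^+ 2 - q ^+ m * theta al x).
Proof. by move=> x0; rewrite /basis /theta !qpochS; field. Qed.

(** The factor on the left is the one that [up] supplies; it cancels the only
    denominator of the shifted basis element, so that shifts need no division.
    [basisS_down] is the image of this identity under the symmetry
    x -> 1/(al x) of the basis. *)
Lemma basisS_up (F : fieldType) (q al : F) m (x : F) : x != 0 -> q != 0 ->
  (1 - al * x) * basis q al m.+1 (x * q)
  = basis q al m x * (1 - (x * q)^-1) * (1 - al * x * q ^+ m)
    * (1 - al * x * q ^+ m.+1).
Proof.
move=> x0 q0; rewrite /basis.
have -> : qpoch (x * q)^-1 q m.+1 = (1 - (x * q)^-1) * qpoch x^-1 q m.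
  by rewrite qpochSl; congr (_ * qpoch _ _ _); field; rewrite x0.
have E : (1 - al * x) * qpoch (al * (x * q)) q m.+1
         = qpoch (al * x) q m * (1 - al * x * q ^+ m) * (1 - al * x * q ^+ m.+1).
  by rewrite mulrA -qpochSl !qpochS.
by rewrite mulrCA E; ring.
Qed.

Lemma basisS_down (F : fieldType) (q al : F) m (x : F) : x != 0 -> q != 0 ->
  (1 - x^-1) * basis q al m.+1 (x / q)
  = basis q al m x * (1 - al * x / q) * (1 - x^-1 * q ^+ m)
    * (1 - x^-1 * q ^+ m.+1).
Proof.
move=> x0 q0; rewrite /basis.
have -> : qpoch (al * (x / q)) q m.+1
          = (1 - al * x / q) * qpoch (al * x) q m.
  by rewrite qpochSl mulrA; congr (_ * qpoch _ _ _); field.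
have E : (1 - x^-1) * qpoch (x / q)^-1 q m.+1
         = qpoch x^-1 q m * (1 - x^-1 * q ^+ m) * (1 - x^-1 * q ^+ m.+1).
  by rewrite invf_div [q / x]mulrC -qpochSl !qpochS.
by rewrite mulrA E; ring.
Qed.

(** The q-Racah recurrence coefficients at x = q^i, for the parameters al,
    p q, 1/n and p^3 q^2 n.  Because al q x^2 = (p q x)^2 they are simpler than
    in general: a factor 1 - p q x cancels against 1 - (p q x)^2 in [up], and
    1 - p x against 1 - (p x)^2 in [down].  The first factors of [up] and
    [down] are kept apart for use with [basisS_up] and [basisS_down]. *)
Definition up_rest (F : fieldType) (q p n x : F) : F :=
  (1 - x / n) * (1 - p ^+ 3 * q ^+ 2 * n * x)
  / ((1 - p ^+ 2 * q * x ^+ 2) * (1 + p * q * x)).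

Definition down_rest (F : fieldType) (q p n x : F) : F :=
  p * x * (1 - p ^+ 2 * q * n * x) * (x - p * q * n)
  / (n * (1 - p ^+ 2 * q * x ^+ 2) * (1 + p * x)).

Definition up (F : fieldType) (q p n x : F) : F :=
  (1 - p ^+ 2 * q * x) * up_rest q p n x.
Definition down (F : fieldType) (q p n x : F) : F :=
  (1 - x^-1) * down_rest q p n x.
Definition mid (F : fieldType) (q p n x : F) : F :=
  1 + p ^+ 2 * q - up q p n x - down q p n x.

(** The coefficient of b_{m-1} in the image of b_m, as a function of y = q^m. *)
Definition lower (F : fieldType) (q p n y : F) : F :=
  - ((1 - p * y) * (1 - y / (n * q)) * (1 - p ^+ 3 * q * n * y) * (1 - y)) / y.

(** The recurrence operator is triangular in the basis; this is a rational
    identity once the common factor b_{m-1}(x) is taken out. *)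
Lemma basis_recurrence (F : fieldType) (q p n x : F) m :
  q != 0 -> n != 0 -> x != 0 ->
  1 - p ^+ 2 * q * x ^+ 2 != 0 -> 1 + p * q * x != 0 -> 1 + p * x != 0 ->
  let al := p ^+ 2 * q in
  up q p n x * basis q al m (x * q) + mid q p n x * basis q al m x
    + down q p n x * basis q al m (x / q)
  = theta al (q ^+ m) * basis q al m x
    + lower q p n (q ^+ m) * basis q al m.-1 x.
Proof.
move=> q0 n0 x0 h1 h2 h3 al.
(* For m = 0 the factor 1 - y of [lower] removes the spurious index 0.-1. *)
case: m => [|m].
  by rewrite /basis !qpoch0 /lower /theta /mid expr0 invr1 /al; ring.
have -> : up q p n x * basis q al m.+1 (x * q)
          = up_rest q p n x * ((1 - al * x) * basis q al m.+1 (x * q)).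
  by rewrite /up -/al; ring.
have -> : down q p n x * basis q al m.+1 (x / q)
          = down_rest q p n x * ((1 - x^-1) * basis q al m.+1 (x / q)).
  by rewrite /down; ring.
rewrite basisS_up // basisS_down // basisS // /= exprS.
have : q ^+ m != 0 by rewrite expf_neq0.
move: (basis q al m x) (q ^+ m) => B y y0.
rewrite /mid /up /down /up_rest /down_rest /lower /theta /al.
field.
by rewrite h1 h2 h3 q0 n0 x0 y0.
Qed.

(** The special feature of these parameters on which the proof rests: it makes
    the twisted recurrence operator a q-commutator of the operator itself with
    theta, up to a constant, also on the diagonal.  It can be expected because
    1 + theta / (p (1 + q)) vanishes exactly at the poles x = -1/p and
    x = -1/(p q) of [mid]. *)
Lemma mid_theta (F : fieldType) (q p n x : F) :
  q != 0 -> p != 0 -> n != 0 -> x != 0 -> 1 + q != 0 ->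
  1 - p ^+ 2 * q * x ^+ 2 != 0 -> 1 + p * q * x != 0 -> 1 + p * x != 0 ->
  mid q p n x * (1 + theta (p ^+ 2 * q) x / (p * (1 + q)))
  = (1 + p) * (p * q * (1 + p) + n^-1 + p ^+ 3 * q ^+ 2 * n) / (p * (1 + q)).
Proof.
move=> q0 p0 n0 x0 q1 h1 h2 h3.
rewrite /mid /up /down /up_rest /down_rest /theta.
field.
by rewrite ?h1 ?h2 ?h3 ?q0 ?n0 ?x0 ?p0 ?q1.
Qed.

(** * The 4phi3 series as a symmetric kernel *)

Definition kcoef (F : fieldType) (q p n : F) (m : nat) : F :=
  q ^+ m / (qpoch (p * q) q m * qpoch n^-1 q m
            * qpoch (p ^+ 3 * q ^+ 2 * n) q m * qpoch q q m).

(** With the expansion of theta y times b_m(y) given by [basisS], this is why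
    the recurrence operator in x and multiplication by theta y agree on the
    kernel: the terms b_m(x) b_{m+1}(y) cancel in pairs. *)
Lemma kcoef_lower (F : fieldType) (q p n : F) m : q != 0 -> n != 0 ->
  qpoch (p * q) q m.+1 != 0 -> qpoch n^-1 q m.+1 != 0 ->
  qpoch (p ^+ 3 * q ^+ 2 * n) q m.+1 != 0 -> qpoch q q m.+1 != 0 ->
  kcoef q p n m.+1 * lower q p n (q ^+ m.+1) = - kcoef q p n m / q ^+ m.
Proof.
move=> q0 n0; rewrite /kcoef !qpochS !mulf_eq0 !negb_or [q ^+ m.+1]exprS.
move=> /andP[a1 b1] /andP[a2 b2] /andP[a3 b3] /andP[a4 b4].
have y0 : q ^+ m != 0 by rewrite expf_neq0.
move: (qpoch _ _ _) a1 (qpoch _ _ _) a2 (qpoch _ _ _) a3 (qpoch _ _ _) a4.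
move=> Q1 a1 Q2 a2 Q3 a3 Q4 a4.
move: (q ^+ m) y0 b1 b2 b3 b4 => y y0 b1 b2 b3 b4.
have b2' : n - y != 0.
  by apply: contraNneq b2 => e; rewrite -[1](mulVf n0) -mulrBr e mulr0.
rewrite /lower; field.
by rewrite q0 n0 y0 a1 a2 a3 a4 b1 b2' b3 b4.
Qed.

Definition kernel (F : fieldType) (q p n : F) (K : nat) (x y : F) : F :=
  \sum_(m < K.+1)
    kcoef q p n m * basis q (p ^+ 2 * q) m x * basis q (p ^+ 2 * q) m y.

Lemma kernelC (F : fieldType) (q p n : F) K x y :
  kernel q p n K x y = kernel q p n K y x.
Proof. by apply: eq_bigr => m _; rewrite mulrAC. Qed.

Lemma kernelS (F : fieldType) (q p n : F) K x y :
  kernel q p n K.+1 x y = kernel q p n K x y +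
    kcoef q p n K.+1 * basis q (p ^+ 2 * q) K.+1 x * basis q (p ^+ 2 * q) K.+1 y.
Proof. by rewrite /kernel big_ord_recr. Qed.

(** Stated for the sum truncated at K, the recurrence has one boundary term, so
    it goes through by induction on K; the term vanishes for K = N at a node
    y = q^j with j <= N. *)
Lemma kernel_recurrence (F : fieldType) (q p n x y : F) K :
  q != 0 -> n != 0 -> x != 0 -> y != 0 ->
  1 - p ^+ 2 * q * x ^+ 2 != 0 -> 1 + p * q * x != 0 -> 1 + p * x != 0 ->
  (forall m, (m <= K)%N ->
    [/\ qpoch (p * q) q m != 0, qpoch n^-1 q m != 0,
        qpoch (p ^+ 3 * q ^+ 2 * n) q m != 0 & qpoch q q m != 0]) ->
  up q p n x * kernel q p n K (x * q) y + mid q p n x * kernel q p n K x y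
    + down q p n x * kernel q p n K (x / q) y
  = theta (p ^+ 2 * q) y * kernel q p n K x y
    + kcoef q p n K / q ^+ K
      * basis q (p ^+ 2 * q) K x * basis q (p ^+ 2 * q) K.+1 y.
Proof.
move=> q0 n0 x0 y0 h1 h2 h3.
elim: K => [|K IHK] hK.
  rewrite /kernel !big_ord1 basisS // /basis !qpoch0 /kcoef !qpoch0 /mid !expr0.
  by rewrite !mulr1 invr1; ring.
have {}IHK := IHK (fun m mK => hK m (leqW mK)).
have [a1 a2 a3 a4] := hK K.+1 (leqnn _).
have E := kcoef_lower q0 n0 a1 a2 a3 a4.
have Rb := basis_recurrence K.+1 q0 n0 x0 h1 h2 h3.
have z0 : q ^+ K.+1 != 0 by rewrite expf_neq0.
have Bs := basisS q (p ^+ 2 * q) K.+1 y0.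
rewrite !kernelS Bs.
move: E Rb IHK => /=.
set b := basis _ _ K.+1 x; set b' := basis _ _ K.+1 y.
set b0 := basis _ _ K x; set bu := basis _ _ _ (x * q).
set bd := basis _ _ _ (x / q); set k1 := kernel _ _ _ _ (x * q) _.
set k2 := kernel _ _ _ _ x _; set k3 := kernel _ _ _ _ (x / q) _.
move=> E Rb IHK.
transitivity (up q p n x * k1 + mid q p n x * k2 + down q p n x * k3
  + kcoef q p n K.+1 * b' *
   (up q p n x * bu + mid q p n x * b + down q p n x * bd)); first by ring.
rewrite IHK Rb.
transitivity (theta (p ^+ 2 * q) y * k2 + kcoef q p n K / q ^+ K * b0 * b'
  + b' * (kcoef q p n K.+1 * theta (p ^+ 2 * q) (q ^+ K.+1) * b)
  + b' * b0 * (kcoef q p n K.+1 * lower q p n (q ^+ K.+1))); first by ring.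
rewrite E /theta; move: (q ^+ K.+1) z0 => z z0; field.
by rewrite z0 y0 expf_neq0.
Qed.

(** * Tridiagonal matrices and the conjugation argument *)

Definition tridiag (F : fieldType) N (u m d : nat -> F) : 'M[F]_N.+1 :=
  \matrix_(i, j) (u i *+ (j == i.+1 :> nat) + m i *+ (j == i :> nat)
                  + d i *+ (i == j.+1 :> nat)).

Lemma sum_pick (F : fieldType) N c (f : nat -> F) :
  \sum_(k < N.+1) f k *+ (k == c :> nat) = f c *+ (c <= N)%N.
Proof.
case: leqP => cN; last first.
  by apply: big1 => k _; rewrite ltn_eqF //; apply: leq_ltn_trans cN;
    rewrite -ltnS.
rewrite (bigD1 (Ordinal (cN : (c < N.+1)%N))) //= eqxx big1 ?addr0 // => k.
by rewrite -val_eqE /= => /negPf ->.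
Qed.

Lemma tridiag_sum (F : fieldType) N (u m d f : nat -> F) (i : 'I_N.+1) :
  u N = 0 -> d 0 = 0 ->
  \sum_(k < N.+1) tridiag N u m d i k * f k
  = u i * f i.+1 + m i * f i + d i * f i.-1.
Proof.
move=> uN d0.
transitivity (\sum_(k < N.+1) (u i * f k *+ (k == i.+1 :> nat)
   + m i * f k *+ (k == i :> nat) + d i * f k *+ (k == i.-1 :> nat))).
  apply: eq_bigr => k _; rewrite mxE !mulrDl !mulrnAl; congr (_ + _).
  (* At i = 0 the spurious term f 0.-1 is removed by d 0 = 0. *)
  case: (val i) => [|i'] /=; first by rewrite d0 !mul0r !mul0rn.
  by rewrite eqSS eq_sym.
rewrite !big_split /=.
rewrite (sum_pick _ _ (fun k => u i * f k)) (sum_pick _ _ (fun k => m i * f k)).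
rewrite (sum_pick _ _ (fun k => d i * f k)).
have iN : (i <= N)%N by rewrite -ltnS.
rewrite iN (leq_trans (leq_pred _) iN) !mulr1n; congr (_ + _ + _).
by case: ltngtP iN => // -> _; rewrite uN !mul0r mul0rn.
Qed.

(** As u i is nonzero, row i of the equation expresses row i + 1 of Y by the
    rows i and i - 1. *)
Lemma tridiag_eigen0 (F : fieldType) N (u m d : nat -> F) (t : 'rV[F]_N.+1)
    (Y : 'M[F]_N.+1) :
  u N = 0 -> d 0 = 0 -> (forall i, (i < N)%N -> u i != 0) ->
  tridiag N u m d *m Y = Y *m diag_mx t -> row 0 Y = 0 -> Y = 0.
Proof.
move=> uN d0 un0 E Y0; apply/matrixP => i j; rewrite mxE.
(* Column j of Y, extended by zero so that its index is a natural number. *)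
pose f k : F := if insub k is Some k' then Y k' j else 0.
have fE (k : 'I_N.+1) : f k = Y k j by rewrite /f valK.
rewrite -fE; suff H k : (k <= N)%N -> f k = 0 by apply: H; rewrite -ltnS.
elim/ltn_ind: k => -[_ _|k IHk kN].
  by have /matrixP/(_ 0 j) := Y0; rewrite !mxE -fE.
have kN' : (k < N.+1)%N by apply: ltnW.
have /matrixP/(_ (Ordinal kN') j) := E.
rewrite mul_mx_diag !mxE.
under eq_bigr do rewrite -fE.
rewrite tridiag_sum //= -fE /= (IHk k) // 1?ltnW //.
rewrite (IHk k.-1) ?mulr0 ?mul0r ?addr0; last 2 first.
- by apply: (leq_ltn_trans (leq_pred _)).
- by apply: (leq_trans (leq_pred _)); apply: ltnW.
by move=> /eqP; rewrite mulf_eq0 (negPf (un0 _ kN)) => /eqP.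
Qed.

(** With T = diag(t) and T P = P A^T, M P is a (q T P T - A P A^T) + d P; each
    term of this is symmetric. *)
Lemma twisted_sym (F : fieldType) N (A P M : 'M[F]_N) (t : 'rV[F]_N)
    (q a d : F) :
  P^T = P -> A *m P = P *m diag_mx t ->
  M = a *: (q *: (diag_mx t *m A) - A *m diag_mx t) + d%:M ->
  M *m P = P *m M^T.
Proof.
move=> PT AP ->.
have TP : diag_mx t *m P = P *m A^T.
  by rewrite -[LHS]trmxK trmx_mul tr_diag_mx PT -AP trmx_mul PT.
have -> : (a *: (q *: (diag_mx t *m A) - A *m diag_mx t) + d%:M)^T
          = a *: (q *: (A^T *m diag_mx t) - diag_mx t *m A^T) + d%:M.
  rewrite !(mul_mx_diag, mul_diag_mx); apply/matrixP => i j.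
  by rewrite !mxE eq_sym; ring.
rewrite mulmxDl mulmxDr scalar_mxC -scalemxAl -scalemxAr.
rewrite mulmxBl mulmxBr -scalemxAl -scalemxAr -!mulmxA AP TP.
have -> : P *m (A^T *m diag_mx t) = diag_mx t *m (P *m diag_mx t).
  by rewrite mulmxA -TP mulmxA.
have -> : P *m (diag_mx t *m A^T) = A *m (P *m A^T).
  by rewrite mulmxA -AP mulmxA.
by [].
Qed.

(** For F = P C P the hypotheses give F T = P C A P = P M^T C P = M F, where T is
    the diagonal matrix of t; conjugation by the diagonal matrix of s, which
    commutes with T, turns M into A. *)
Lemma conj_eigen (F : fieldType) N (A P M C : 'M[F]_N) (t s : 'rV[F]_N) :
  (forall i, s 0 i != 0) -> M *m diag_mx s = diag_mx s *m A ->
  A *m P = P *m diag_mx t -> M *m P = P *m M^T -> M^T *m C = C *m A ->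
  let si := diag_mx (\row_i (s 0 i)^-1) in
  let G := si *m (P *m C *m P) *m si in
  A *m G = G *m diag_mx t.
Proof.
move=> s0 MS AP MP MC si G.
have sK : diag_mx s *m si = 1%:M.
  by rewrite mulmx_diag; apply/matrixP => i j; rewrite !mxE mulfV.
have {}MS : A *m si = si *m M.
  have siK : si *m diag_mx s = 1%:M by rewrite diag_mxC.
  by rewrite -[A]mul1mx -siK -[si *m _ *m A]mulmxA -MS -!mulmxA sK mulmx1.
have tsi : si *m diag_mx t = diag_mx t *m si by rewrite diag_mxC.
have MF : M *m (P *m C *m P) = P *m C *m P *m diag_mx t.
  by rewrite !mulmxA MP -[P *m M^T *m C]mulmxA MC -!mulmxA AP.
rewrite /G; move: (P *m C *m P) MF => X MX.
by rewrite -!mulmxA tsi !mulmxA MS -[si *m M *m X]mulmxA MX !mulmxA.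
Qed.

(** * The very-well-poised weights *)

(** The summand of the terminating very-well-poised 6phi5 series with
    parameters al, b, c, q^-N in the limit c -> 0. *)
Definition vwp (F : fieldType) (q al b : F) (N k : nat) : F :=
  (-1) ^+ k / q ^+ 'C(k, 2) * (q ^+ N / b) ^+ k
  * ((1 - al * q ^+ k ^+ 2) / (1 - al))
  * (qpoch al q k * qpoch b q k * qpoch (q ^+ N)^-1 q k
     / (qpoch q q k * qpoch (al * q / b) q k * qpoch (al * q ^+ N.+1) q k)).

(** Creative telescoping: the two coefficients are those of the first-order
    recurrence in N that the closed form in [vwp_sum] satisfies, and the right
    side is the certificate, the partial sum in closed form. *)
Lemma vwp_telescope (F : fieldType) (q al b : F) N K :
  q != 0 -> b != 0 -> (forall m, 1 - al * q ^+ m != 0) ->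
  (forall m, 1 - q ^+ m.+1 != 0) ->
  (forall m, (m < K)%N -> 1 - al * q / b * q ^+ m != 0) ->
  \sum_(k < K.+1) ((b - al * q ^+ N.+1) * vwp q al b N.+1 k
                   - (1 - al * q ^+ N.+1) * vwp q al b N k)
  = (b - 1) * ((-1) ^+ K / q ^+ 'C(K, 2) * (q ^+ N / b) ^+ K)
    * (qpoch (al * q) q K * qpoch (b * q) q K * qpoch (q ^+ N)^-1 q K
       / (qpoch q q K * qpoch (al * q / b) q K * qpoch (al * q ^+ N.+2) q K)).
Proof.
move=> q0 b0 alq qq.
have al0 : 1 - al != 0 by have := alq 0; rewrite expr0 mulr1.
elim: K => [|K IHK] hK.
  rewrite big_ord1 /vwp !qpoch0 !expr0.
  by field; rewrite oner_eq0 al0.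
rewrite big_ord_recr /= IHK; last by move=> m mK; apply: hK; apply: ltnW.
have n0 : q ^+ N != 0 by rewrite expf_neq0.
have y0 : q ^+ K != 0 by rewrite expf_neq0.
rewrite /vwp binS2 exprD [(-1) ^+ K.+1]exprS.
(* All products are expressed by those of the certificate at K, which leaves a
   rational identity in q^K and q^N. *)
have -> : (q ^+ N.+1 / b) ^+ K.+1 = (q ^+ N / b) ^+ K * q ^+ K * (q ^+ N * q / b).
  by rewrite exprSr [q ^+ N.+1]exprSr mulrAC exprMn.
have -> : (q ^+ N / b) ^+ K.+1 = (q ^+ N / b) ^+ K * (q ^+ N / b).
  by rewrite exprSr.
have -> : qpoch (q ^+ N.+1)^-1 q K.+1
          = (1 - (q ^+ N * q)^-1) * qpoch (q ^+ N)^-1 q K.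
  rewrite qpochSl exprSr; congr (_ * qpoch _ _ _); field.
  by rewrite q0 n0.
have -> : qpoch (al * q ^+ N.+1) q K.+1
          = (1 - al * (q ^+ N * q)) * qpoch (al * q ^+ N.+2) q K.
  by rewrite qpochSl [q ^+ N.+2]exprSr !exprSr !mulrA.
have p5 : qpoch (al * q / b) q K.+1 != 0 by apply: qpoch_neq0.
have p6 : qpoch q q K.+1 != 0.
  by apply: qpoch_neq0 => m _; rewrite -exprS.
have p4 : qpoch (al * q ^+ N.+2) q K.+1 != 0.
  by apply: qpoch_neq0 => m _; rewrite -mulrA -exprD.
have h1 : 1 - al * (q ^+ N * q) != 0 by rewrite -exprSr.
rewrite (qpochSl al) (qpochSl b) !(qpochS (q ^+ N)^-1).
rewrite !(qpochS (al * q)) !(qpochS (b * q)).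
move: p4 p5 p6; rewrite !(qpochS q) !(qpochS (al * q / b)).
rewrite !(qpochS (al * q ^+ N.+2)) !exprSr.
rewrite !mulf_eq0 !negb_or => /andP[p4 h4] /andP[p5 h5] /andP[p6 h6].
have h5' : b - al * q * q ^+ K != 0.
  apply: contraNneq h5 => e.
  have -> : 1 - al * q / b * q ^+ K = (b - al * q * q ^+ K) / b by field.
  by rewrite e mul0r.
have c0 : q ^+ 'C(K, 2) != 0 by rewrite expf_neq0.
move: (qpoch (al * q) q K) (qpoch (b * q) q K) (qpoch (q ^+ N)^-1 q K).
set P4 := qpoch (al * (q ^+ N * q * q)) q K in p4 h4 *.
move: P4 (qpoch (al * q / b) q K) (qpoch q q K) p4 h4 p5 p6.
move: ((-1) ^+ K) ((q ^+ N / b) ^+ K) => s r.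
move: (q ^+ 'C(K, 2)) c0 (q ^+ K) y0 h5' h6 {h5} (q ^+ N) n0 h1.
move=> c c0 y y0 h5 h6 n n0 h1 P4 P5 P6 p4 h4 p5 p6 P1 P2 P3.
field.
by rewrite p4 p5 p6 h1 h4 h5 h6 al0 c0 y0 n0 q0 b0.
Qed.

(** Induction on N by [vwp_telescope] at K = N + 1, where the certificate
    contains the vanishing factor (q^-N; q)_{N+1}. *)
Lemma vwp_sum (F : fieldType) (q al b : F) N :
  q != 0 -> b != 0 -> (forall m, 1 - al * q ^+ m != 0) ->
  (forall m, 1 - q ^+ m.+1 != 0) ->
  (forall m, (m < N)%N -> 1 - al * q / b * q ^+ m != 0) ->
  \sum_(k < N.+1) vwp q al b N k
  = qpoch (al * q) q N / (b ^+ N * qpoch (al * q / b) q N).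
Proof.
move=> q0 b0 alq qq.
have al0 : 1 - al != 0 by have := alq 0; rewrite expr0 mulr1.
elim: N => [|N IHN] hN.
  by rewrite big_ord1 /vwp !qpoch0 !expr0; field; rewrite oner_eq0 al0.
have := vwp_telescope N q0 b0 alq qq hN.
rewrite qpoch_qV0 // !(mulr0, mul0r) sumrB -!mulr_sumr => /subr0_eq.
have v0 : vwp q al b N N.+1 = 0.
  by rewrite /vwp [qpoch (q ^+ N)^-1 _ _]qpoch_qV0 // !(mulr0, mul0r).
rewrite [X in _ = _ * X -> _]big_ord_recr /= v0 addr0 IHN; last first.
  by move=> m mN; apply/hN/ltnW.
have hb : b - al * q ^+ N.+1 != 0.
  apply: contraNneq (hN N (leqnn _)) => e.
  have -> : 1 - al * q / b * q ^+ N = (b - al * q ^+ N.+1) / b.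
    by rewrite exprS; field.
  by rewrite e mul0r.
move=> e; apply: (mulfI hb); rewrite e !qpochS.
have -> : al * q * q ^+ N = al * q ^+ N.+1 by rewrite exprS mulrA.
have p5 : qpoch (al * q / b) q N != 0.
  by apply: qpoch_neq0 => m mN; apply/hN/ltnW.
have -> : 1 - al * q / b * q ^+ N = (b - al * q ^+ N.+1) / b.
  by rewrite exprS; field.
rewrite [b ^+ N.+1]exprSr; have bN : b ^+ N != 0 by rewrite expf_neq0.
by field; rewrite p5 bN b0 hb.
Qed.

(** The weights satisfy the detailed balance relation of the recurrence twisted
    by - p q^(k+1), the ratio of consecutive entries of [twist]. *)
Lemma vwp_balance (F : fieldType) (q p : F) N k :
  let n := q ^+ N in generic q p -> (k < N)%N ->
  let c := vwp q (p ^+ 2 * q) (p ^+ 3 * q ^+ 2 * n) N in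
  c k * up q p n (q ^+ k)
  = - (c k.+1 * (p * q ^+ k.+1 * down q p n (q ^+ k.+1))).
Proof.
move=> n gen kN c; have q0 := gen_q gen; have p0 := gen_p gen.
have alq m := p2qX_neq0 m gen.
have n0 : n != 0 by rewrite expf_neq0.
have al0 : 1 - p ^+ 2 * q != 0 by have := alq 0; rewrite expr0 mulr1.
have y0 : q ^+ k != 0 by rewrite expf_neq0.
have c0 : q ^+ 'C(k, 2) != 0 by rewrite expf_neq0.
have alb : p ^+ 2 * q * q / (p ^+ 3 * q ^+ 2 * n) = (p * n)^-1.
  by field; rewrite p0 q0 n0.
have eS : q ^+ k.+1 = q * q ^+ k by rewrite exprS.
have h1 : 1 - p ^+ 2 * q * q ^+ k ^+ 2 != 0 by rewrite -exprM.
have h2 : 1 - p ^+ 2 * q * (q * q ^+ k) ^+ 2 != 0 by rewrite -eS -exprM.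
have h3 : 1 + p * (q * q ^+ k) != 0 by rewrite -eS (gen_pN1 gen).
have p4 : qpoch (p ^+ 2 * q * q ^+ N.+1) q k.+1 != 0.
  by apply: qpoch_neq0 => m _; rewrite -mulrA -exprD.
have p5 : qpoch (p * n)^-1 q k.+1 != 0.
  by apply: qpoch_neq0 => m mk; apply: pqX_sub gen (leq_trans mk _).
have p6 : qpoch q q k.+1 != 0.
  by apply: qpoch_neq0 => m _; rewrite -exprS (gen_q1 gen).
rewrite /c /vwp alb binS2 exprD [(-1) ^+ k.+1]exprS -/n.
rewrite eS [(_ / _) ^+ k.+1]exprS.
move: p4 p5 p6; rewrite !qpochS.
rewrite !mulf_eq0 !negb_or => /andP[p4 h4] /andP[p5 h5] /andP[p6 h6].
have h5' : p * n - q ^+ k != 0.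
  apply: contraNneq h5 => e.
  have -> : 1 - (p * n)^-1 * q ^+ k = (p * n - q ^+ k) / (p * n).
    by field; rewrite n0 p0.
  by rewrite e mul0r.
move: p4 h4; rewrite [q ^+ N.+1]exprS -/n => p4 h4.
move: (qpoch (p ^+ 2 * q) q k) (qpoch (p ^+ 3 * q ^+ 2 * n) q k) (qpoch n^-1 q k).
move: (qpoch _ q k) p4 (qpoch _ q k) p5 (qpoch _ q k) p6.
move=> P4 p4 P5 p5 P6 p6 P1 P2 P3.
rewrite /up /down /up_rest /down_rest.
move: ((-1) ^+ k) ((n / (p ^+ 3 * q ^+ 2 * n)) ^+ k) => s r.
move: (q ^+ 'C(k, 2)) c0 (q ^+ k) y0 h1 h2 h3 h4 h5' h6 {h5}.
move=> C c0 y y0 h1 h2 h3 h4 h5 h6.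
clear kN alb c; clearbody n.
by field; rewrite h1 h2 h3 h4 h5 h6 al0 c0 p4 p5 p6 y0 n0 p0 q0.
Qed.

(** * The twisted self-duality of the kernel *)

Section Generic.
Variables (F : fieldType) (q p : F) (N : nat) (gen : generic q p).

Let n : F := q ^+ N.
Let q0 : q != 0 := gen_q gen.
Let p0 : p != 0 := gen_p gen.
Let qX0 m : q ^+ m != 0 := qX_neq0 m gen.
Let n0 : n != 0. Proof. exact: qX0. Qed.

(** The diagonal entries of S. *)
Definition twist (i : nat) : F := (-1) ^+ i * q ^+ 'C(i, 2) * (p * q) ^+ i.
Definition weight (k : nat) : F := vwp q (p ^+ 2 * q) (p ^+ 3 * q ^+ 2 * n) N k.

(* A, P, C and M are the matrices of the introduction; [tm] and [sm] are the
   diagonals of Theta and S. *)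
Let tm : 'rV[F]_N.+1 := \row_i theta (p ^+ 2 * q) (q ^+ i).
Let sm : 'rV[F]_N.+1 := \row_i twist i.
Let u i := up q p n (q ^+ i).
Let d i := down q p n (q ^+ i).
Let m i := mid q p n (q ^+ i).
Let A : 'M[F]_N.+1 := tridiag N u m d.
Let P : 'M[F]_N.+1 := \matrix_(i, j) kernel q p n N (q ^+ i) (q ^+ j).
Let C : 'M[F]_N.+1 := diag_mx (\row_i weight i).
Let M : 'M[F]_N.+1 := \matrix_(i, j) (twist i * A i j / twist j).

Lemma twist_neq0 i : twist i != 0.
Proof. by rewrite /twist !mulf_neq0 ?expf_neq0 ?oppr_eq0 ?oner_eq0 ?mulf_neq0. Qed.

Lemma twistS i : twist i.+1 = - (p * q ^+ i.+1) * twist i.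
Proof. by rewrite /twist binS2 exprD !exprSr; ring. Qed.

Let uN : u N = 0.
Proof. by rewrite /u /up /up_rest mulfV // subrr !mul0r mulr0. Qed.

Let d0 : d 0 = 0.
Proof. by rewrite /d /down expr0 invr1 subrr mul0r. Qed.

Let den0 i : [&& 1 - p ^+ 2 * q * q ^+ i ^+ 2 != 0,
  1 + p * q * q ^+ i != 0 & 1 + p * q ^+ i != 0].
Proof.
have -> : p ^+ 2 * q * q ^+ i ^+ 2 = p ^+ 2 * q ^+ (i * 2).+1.
  by rewrite -exprM -mulrA -exprS.
have -> : p * q * q ^+ i = p * q ^+ i.+1 by rewrite -mulrA -exprS.
by rewrite (gen_p2 gen) !(gen_pN1 gen).
Qed.

Let un0 i : (i < N)%N -> u i != 0.
Proof.
move=> iN; have /and3P[h1 h2 h3] := den0 i.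
rewrite /u /up /up_rest !mulf_neq0 ?invr_eq0 ?mulf_neq0 ?(qX_sub gen) //.
  exact: p2qX_neq0.
exact: p3qX_neq0.
Qed.

Let basis_vanish k i : (i < k)%N -> basis q (p ^+ 2 * q) k (q ^+ i) = 0.
Proof. by move=> ik; rewrite /basis qpoch_qV0 // mul0r. Qed.

Let kcoef_den0 k : (k <= N)%N ->
  [/\ qpoch (p * q) q k != 0, qpoch n^-1 q k != 0,
      qpoch (p ^+ 3 * q ^+ 2 * n) q k != 0 & qpoch q q k != 0].
Proof.
move=> kN; split; apply: qpoch_neq0 => l lk.
- by rewrite -mulrA -exprS (gen_p1 gen).
- by rewrite mulrC (qX_sub gen) // (leq_trans lk).
- exact: p3qX_neq0.
- by rewrite -exprS (gen_q1 gen).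
Qed.

(** The entries P (N + 1) j and P (-1) j that the recurrence would need for the
    last and the first row have the coefficients u N = 0 and d 0 = 0. *)
Let AP : A *m P = P *m diag_mx tm.
Proof.
apply/matrixP => i j; rewrite mul_mx_diag !mxE.
pose f k := kernel q p n N (q ^+ k) (q ^+ j).
transitivity (\sum_k A i k * f k).
  by apply: eq_bigr => k _; rewrite [P k j]mxE.
rewrite tridiag_sum // /f.
have /and3P[h1 h2 h3] := den0 i.
have := @kernel_recurrence _ q p n (q ^+ i) (q ^+ j) N
  q0 n0 (qX0 i) (qX0 j) h1 h2 h3 kcoef_den0.
rewrite (@basis_vanish N.+1 j) // mulr0 addr0 -exprSr => R.
rewrite [RHS]mulrC -R; congr (_ + _).
case: (val i) => [|k]; first by rewrite d0 /down expr0 invr1 subrr !mul0r.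
by have -> : q ^+ k.+1 / q = q ^+ k by rewrite exprSr mulfK.
Qed.

Let PT : P^T = P.
Proof. by apply/matrixP => i j; rewrite !mxE kernelC. Qed.

(** One of the two terms cancels in q theta_i - theta_{i+1}, the other one in
    q theta_{i+1} - theta_i; what remains is p (1 - q^2) times the quotient of
    the entries i and i + 1 of [twist], or its inverse.  This settles the
    entries off the diagonal. *)
Let Mq : M = (p * (1 - q ^+ 2))^-1 *:
   (q *: (diag_mx tm *m A) - A *m diag_mx tm)
  + ((1 + p) * (p * q * (1 + p) + n^-1 + p ^+ 3 * q ^+ 2 * n) / (p * (1 + q)))%:M.
Proof.
have q1 : 1 - q != 0 by exact: (gen_q1 gen 0).
have q2 : 1 + q != 0.
  have := gen_q1 gen 1; apply: contraNneq => e.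
  have -> : 1 - q ^+ 2 = (1 + q) * (1 - q) by ring.
  by rewrite e mul0r.
have q3 : 1 - q ^+ 2 != 0 by exact: (gen_q1 gen 1).
apply/matrixP => i j; rewrite mul_mx_diag mul_diag_mx !mxE.
have /and3P[h1 h2 h3] := den0 i.
rewrite -(inj_eq val_inj) /=.
have H := mid_theta q0 p0 n0 (qX0 i) q2 h1 h2 h3.
case: (ltngtP i j) => ij.
- rewrite !(ltn_eqF (leqW ij)) addr0.
  case: (eqVneq (j : nat) i.+1) => [->|_]; last first.
    by rewrite !mulr0n; ring.
  rewrite !mulr0n mulr1n !addr0 twistS /theta exprSr.
  move: (q ^+ i) (qX0 i) (twist i) (twist_neq0 i) (u i) => x x0 s s0 w.
  by field; rewrite oppr_eq0 !mulf_neq0 ?p0 ?q0 ?x0 ?s0 ?q3.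
- rewrite (ltn_eqF (leqW ij)).
  case: (eqVneq (i : nat) j.+1) => [->|_]; last first.
    by rewrite !mulr0n; ring.
  rewrite !mulr0n mulr1n !addr0 !add0r twistS /theta exprSr.
  move: (q ^+ j) (qX0 j) (twist j) (twist_neq0 j) (d j.+1) => x x0 s s0 w.
  by field; rewrite p0 q0 x0 s0 q3.
- rewrite ij (ltn_eqF (leqnn _)) !mulr0n addr0 add0r !mulr1n.
  rewrite -H -[m j]/(mid q p n (q ^+ j)) ij.
  move: (mid _ _ _ _) (theta _ _) (twist j) (twist_neq0 j) => w t s s0.
  by field; rewrite p0 q2 s0 q3.
Qed.

Let MC : M^T *m C = C *m A.
Proof.
have bal k : (k < N)%N ->
    weight k * u k = - (weight k.+1 * (p * q ^+ k.+1 * d k.+1)).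
  exact: vwp_balance.
rewrite mul_mx_diag mul_diag_mx; apply/matrixP => i j; rewrite !mxE.
case: (ltngtP i j) => ij.
- rewrite !(ltn_eqF (leqW ij)) addr0.
  case: (eqVneq (j : nat) i.+1) => [e|_]; last first.
    by rewrite !mulr0n; ring.
  have iN : (i < N)%N by rewrite -e -ltnS.
  rewrite !mulr0n !mulr1n !addr0 !add0r bal // e twistS.
  move: (twist i) (twist_neq0 i) (weight _) (d _) => s s0 w v.
  by field.
- rewrite (ltn_eqF (leqW ij)).
  case: (eqVneq (i : nat) j.+1) => [e|_]; last first.
    by rewrite !mulr0n; ring.
  rewrite !mulr0n mulr1n !addr0 !add0r.
  have jN : (j < N)%N by rewrite -e -ltnS.
  have := bal j jN; rewrite e twistS.
  move: (q ^+ j.+1) (qX0 j.+1) (twist j) (twist_neq0 j) (d j.+1) => x x0 s s0 v.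
  move: (weight j) (weight j.+1) (u j) => w w' v' E.
  have -> : s * v' / (- (p * x) * s) * w = - (w * v') / (p * x).
    by field; rewrite oppr_eq0 !mulf_neq0 ?p0 ?s0 ?x0.
  by rewrite E mulr1n; field; rewrite p0 x0.
- rewrite ij (ltn_eqF (leqnn _)) !mulr0n addr0 add0r !mulr1n.
  by move: (twist j) (twist_neq0 j) => s s0; field.
Qed.

Let MS : M *m diag_mx sm = diag_mx sm *m A.
Proof.
rewrite mul_mx_diag mul_diag_mx; apply/matrixP => i j; rewrite !mxE.
by rewrite mulfVK ?twist_neq0.
Qed.

Lemma kernel_one y : kernel q p n N 1 y = 1.
Proof.
rewrite /kernel big_ord_recl big1 => [|k _]; last first.
  by rewrite -[1](expr0 q) basis_vanish // mulr0 mul0r.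
by rewrite /kcoef /basis !qpoch0 expr0 !mulr1 divr1 addr0.
Qed.

(** The identity up to the value of the constant. *)
Lemma kernel_twist i j : (i <= N)%N -> (j <= N)%N ->
  \sum_(k < N.+1) weight k * kernel q p n N (q ^+ i) (q ^+ k)
                  * kernel q p n N (q ^+ k) (q ^+ j)
  = (\sum_(k < N.+1) weight k) * (twist i * twist j)
    * kernel q p n N (q ^+ i) (q ^+ j).
Proof.
move=> iN jN.
have sm0 k : sm 0 k != 0 by rewrite mxE twist_neq0.
pose si := diag_mx (\row_k (sm 0 k)^-1).
pose G := si *m (P *m C *m P) *m si.
have AG : A *m G = G *m diag_mx tm.
  exact: conj_eigen sm0 MS AP (twisted_sym PT AP Mq) MC.
have siT : si^T = si by rewrite tr_diag_mx.
have CT : C^T = C by rewrite tr_diag_mx.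
have GT : G^T = G by rewrite /G !trmx_mul siT CT PT !mulmxA.
(* P has first row 1, so the columns of P scaled by the first row of G form the
   solution with the same first row as G. *)
have Y0 : G - P *m diag_mx (row 0 G) = 0.
  apply: (tridiag_eigen0 uN d0 un0 (m := m) (t := tm)).
    by rewrite -/A mulmxBr mulmxBl AG mulmxA AP -!mulmxA [diag_mx tm *m _]diag_mxC.
  by apply/rowP => k; rewrite mul_mx_diag !mxE kernel_one mul1r subrr.
have GE k l : G k l = P k l * G 0 0.
  have E k' l' : G k' l' = P k' l' * G 0 l'.
    by move/subr0_eq: Y0 => /matrixP/(_ k' l'); rewrite mul_mx_diag !mxE.
  rewrite E; congr (_ * _); rewrite -[in LHS]GT mxE E.
  by rewrite mxE kernelC kernel_one mul1r.
have Gsum k l : G k l = (twist k * twist l)^-1 * \sum_(h < N.+1)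
    weight h * kernel q p n N (q ^+ k) (q ^+ h) * kernel q p n N (q ^+ h) (q ^+ l).
  rewrite /G /si mul_mx_diag mul_diag_mx !mxE [(twist k * _)^-1]invfM [LHS]mulrAC.
  congr (_ * _); apply: eq_bigr => h _.
  by rewrite mul_mx_diag !mxE [weight _ * _]mulrC.
have G00 : G 0 0 = \sum_(k < N.+1) weight k.
  rewrite Gsum /twist bin0n !expr0 !mulr1 invr1 mul1r; apply: eq_bigr => h _.
  by rewrite kernel_one kernelC kernel_one !mulr1.
have := GE (inord i) (inord j); rewrite Gsum G00 mxE !inordK // => E.
have ss0 : twist i * twist j != 0 by rewrite mulf_neq0 ?twist_neq0.
rewrite (canRL (mulVKf ss0) E); ring.
Qed.

End Generic.

(** In [vwp_sum] the denominator product is (1/(p n); q)_N, which [qpoch_rev]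
    turns into (p q; q)_N. *)
Lemma weight_sum (F : fieldType) (q p : F) N : generic q p ->
  \sum_(k < N.+1) weight q p N k
  = (-1) ^+ N / q ^+ 'C(N, 2) / (p * q) ^+ (2 * N)
    * (qpoch (p ^+ 2 * q ^+ 2) q N / qpoch (p * q) q N).
Proof.
move=> gen; have q0 := gen_q gen; have p0 := gen_p gen.
set n := q ^+ N; have n0 : n != 0 by rewrite expf_neq0.
have alb : p ^+ 2 * q * q / (p ^+ 3 * q ^+ 2 * n) = (p * n)^-1.
  by field; rewrite p0 q0 n0.
rewrite /weight vwp_sum ?mulf_neq0 ?expf_neq0 //; last 3 first.
- by move=> m; apply: p2qX_neq0.
- exact: (gen_q1 gen).
- by move=> m mN; rewrite alb pqX_sub.
have R := qpoch_rev N p0 q0.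
have pq0 : qpoch (p * q) q N != 0.
  by apply: qpoch_neq0 => m _; rewrite -mulrA -exprS (gen_p1 gen).
have c0 : q ^+ 'C(N, 2) != 0 by rewrite expf_neq0.
have pN : p ^+ N != 0 by rewrite expf_neq0.
have eN : n ^+ N = q ^+ 'C(N, 2) ^+ 2 * n.
  rewrite /n -!exprM -exprD; congr (q ^+ _).
  by elim: (N) => [|k IHk]; rewrite ?binS2 //; lia.
have eb : (p ^+ 3 * q ^+ 2 * n) ^+ N
    = p ^+ N ^+ 3 * n ^+ 2 * (q ^+ 'C(N, 2) ^+ 2 * n).
  by rewrite 2!exprMn eN [(p ^+ 3) ^+ N]exprAC [(q ^+ 2) ^+ N]exprAC.
have e2 : p ^+ 2 * q * q = p ^+ 2 * q ^+ 2 by ring.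
rewrite alb e2 eb mulnC exprM [(p * q) ^+ N]exprMn -/n.
have s0 : (-1) ^+ N != 0 :> F by rewrite expf_neq0 // oppr_eq0 oner_eq0.
have s1 : (-1) ^+ N * (-1) ^+ N = 1 :> F by rewrite -exprMn mulrNN mulr1 expr1n.
have E : qpoch (p * n)^-1 q N
   = (-1) ^+ N * qpoch (p * q) q N / (p ^+ N * (q ^+ 'C(N, 2) * n)).
  by rewrite -R mulfK // !mulf_neq0.
rewrite E.
move: (qpoch (_ ^+ 2 * _) _ _) (qpoch _ _ _) pq0 (q ^+ 'C(N, 2)) c0 => Q Q' Q'0 c c0.
move: (p ^+ N) pN ((-1) ^+ N) s0 s1 => y y0 s s0 s1.
(* The two forms differ by the square of the sign (-1)^N. *)
transitivity (1 * Q / (y ^+ 2 * n ^+ 2 * c * s * Q')).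
  by field; rewrite y0 n0 c0 s0 Q'0.
by rewrite -s1; field; rewrite y0 n0 c0 s0 Q'0.
Qed.

(** * Back to the q-Racah polynomials *)

(** For min(x, y) < m <= N one of (q^-x; q)_m and (q^-y; q)_m vanishes, while the
    denominators do not; so all the series may be summed over 0 <= m <= N. *)
Lemma phi43_kernel (F : fieldType) (q : F) a N x y : q != 0 ->
  (x <= N)%N -> (y <= N)%N ->
  phi43 (minn x y)
    (q ^ (- x%:Z)) (q ^+ (2 * a + x + 1)) (q ^ (- y%:Z)) (q ^+ (2 * a + y + 1))
    (q ^+ (a + 1)) (q ^ (- N%:Z)) (q ^+ (3 * a + N + 2)) q q
  = kernel q (q ^+ a) (q ^+ N) N (q ^+ x) (q ^+ y).
Proof.
move=> q0 xN yN; rewrite /phi43 /kernel.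
rewrite -(big_mkord xpredT (fun m => kcoef q (q ^+ a) (q ^+ N) m *
  basis q (q ^+ a ^+ 2 * q) m (q ^+ x) * basis q (q ^+ a ^+ 2 * q) m (q ^+ y))).
have le_min : (minn x y <= N)%N by rewrite geq_min xN.
rewrite [RHS](big_cat_nat _ (n := (minn x y).+1)) //=.
rewrite [X in _ = _ + X]big1_seq ?addr0; last first.
  move=> m; rewrite mem_index_iota gtn_min => /andP[_ /andP[/orP[] lt_m _]].
    by rewrite /basis (qpoch_qV0 q0 lt_m) mul0r mulr0 mul0r.
  by rewrite /basis (qpoch_qV0 q0 lt_m) mul0r mulr0.
apply: eq_bigr => m _; rewrite /qpochs !big_cons !big_nil -!exprnN /kcoef /basis.
have e z : q ^+ (2 * a + z + 1) = q ^+ a ^+ 2 * q * q ^+ z.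
  by rewrite -exprM -!exprSr -exprD; congr (_ ^+ _); lia.
have -> : q ^+ (3 * a + N + 2) = q ^+ a ^+ 3 * q ^+ 2 * q ^+ N.
  by rewrite -exprM -!exprD; congr (_ ^+ _); lia.
have -> : q ^+ (a + 1) = q ^+ a * q by rewrite addn1 exprSr.
by rewrite !e !invfM invr1; ring.
Qed.

Lemma coef_weight (F : fieldType) (q : F) a N k : q != 0 ->
  coef q a N k = weight q (q ^+ a) N k.
Proof.
move=> q0; have a0 : q ^+ a != 0 by rewrite expf_neq0.
have n0 : q ^+ N != 0 by rewrite expf_neq0.
rewrite /coef /weight /vwp /qpochs !big_cons !big_nil !mulr1 -!exprnN.
have e1 : q ^+ (2 * a + 1) = q ^+ a ^+ 2 * q.
  by rewrite -exprM -exprSr; congr (_ ^+ _); lia.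
have e2 : q ^+ (3 * a + N + 2) = q ^+ a ^+ 3 * q ^+ 2 * q ^+ N.
  by rewrite -exprM -!exprD; congr (_ ^+ _); lia.
have -> : q ^+ (2 * a + 1 + 2 * k) = q ^+ a ^+ 2 * q * q ^+ k ^+ 2.
  by rewrite exprD e1 mulnC exprM.
have -> : q ^+ (2 * a + N + 2) = q ^+ a ^+ 2 * q * q ^+ N.+1.
  by rewrite -exprM -exprSr -exprD; congr (_ ^+ _); lia.
have -> : q ^ (- a%:Z - N%:Z)
          = q ^+ a ^+ 2 * q * q / (q ^+ a ^+ 3 * q ^+ 2 * q ^+ N).
  by rewrite -opprD -PoszD -exprnN exprD; field; rewrite a0 q0 n0.
have -> : q ^+ N / (q ^+ a ^+ 3 * q ^+ 2 * q ^+ N) = q ^- (3 * a + 2).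
  by rewrite exprD mulnC exprM; field; rewrite a0 q0 n0.
by rewrite e1 e2 mulnC exprM exprVn !mulrA.
Qed.

Lemma qRacah_kernel (F : fieldType) (q : F) a N x y : q != 0 ->
  (x <= N)%N -> (y <= N)%N ->
  qRacah x y (q ^+ a) (q ^+ a) (q ^+ (3 * a + N + 1))
    (q ^ (- a%:Z - N%:Z - 1)) q
  = kernel q (q ^+ a) (q ^+ N) N (q ^+ x) (q ^+ y).
Proof.
move=> q0 xN yN; rewrite -phi43_kernel // /qRacah; congr phi43.
- by rewrite -!exprD; congr (_ ^+ _); lia.
- rewrite !exprnP -!expfzDr //; congr (_ ^ _); lia.
- by rewrite addn1 exprSr.
- rewrite !exprnP -[X in _ * X]expr1z -!expfzDr //; congr (_ ^ _); lia.
- by rewrite -exprSr; congr (_ ^+ _); lia.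
Qed.

Lemma twist_constant (F : fieldType) (q : F) a N i j : generic q (q ^+ a) ->
  (\sum_(k < N.+1) weight q (q ^+ a) N k)
  * (twist q (q ^+ a) i * twist q (q ^+ a) j)
  = (-1) ^ (i%:Z + j%:Z - N%:Z)
     * q ^ (('C(i, 2))%:Z + ('C(j, 2))%:Z - ('C(N, 2))%:Z)
     * q ^ ((i%:Z + j%:Z - 2%:Z * N%:Z) * (a%:Z + 1))
     * (qpoch (q ^+ (2 * a + 2)) q N / qpoch (q ^+ (a + 1)) q N).
Proof.
move=> gen; have q0 := gen_q gen.
have m1 : (-1 : F) != 0 by rewrite oppr_eq0 oner_eq0.
rewrite weight_sum // /twist.
have -> : q ^+ (2 * a + 2) = q ^+ a ^+ 2 * q ^+ 2.
  by rewrite -exprM -exprD mulnC.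
have -> : q ^+ (a + 1) = q ^+ a * q by rewrite addn1 exprSr.
set r := q ^+ a * q; have r0 : r != 0 by rewrite mulf_neq0 ?expf_neq0.
have -> : q ^ ((i%:Z + j%:Z - 2%:Z * N%:Z) * (a%:Z + 1))
          = r ^ (i%:Z + j%:Z - (2 * N)%N%:Z).
  have -> : r = q ^ (a%:Z + 1) by rewrite /r -exprSr -addn1 exprnP PoszD.
  by rewrite exprz_exp mulrC PoszM.
rewrite !expfzDr // -!exprnN -!exprnP.
have -> : (-1) ^- N = (-1) ^+ N :> F by rewrite -exprVn invrN1.
by ring.
Qed.

Theorem proposition4p1 (R : realFieldType) (q : R) (hq0 : 0 < q) (hq1 : q < 1)
    (a N i j : nat) (hi : (i <= N)%N) (hj : (j <= N)%N) :
  (\sum_(0 <= k < N.+1)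
      coef q a N k
      * phi43 (minn i k)
          (q ^ (- i%:Z)) (q ^+ (2 * a + i + 1))
          (q ^ (- k%:Z)) (q ^+ (2 * a + k + 1))
          (q ^+ (a + 1)) (q ^ (- N%:Z)) (q ^+ (3 * a + N + 2)) q q
      * phi43 (minn k j)
          (q ^ (- k%:Z)) (q ^+ (2 * a + k + 1))
          (q ^ (- j%:Z)) (q ^+ (2 * a + j + 1))
          (q ^+ (a + 1)) (q ^ (- N%:Z)) (q ^+ (3 * a + N + 2)) q q
   = (-1) ^ (i%:Z + j%:Z - N%:Z)
     * q ^ (('C(i, 2))%:Z + ('C(j, 2))%:Z - ('C(N, 2))%:Z)
     * q ^ ((i%:Z + j%:Z - 2%:Z * N%:Z) * (a%:Z + 1))
     * (qpoch (q ^+ (2 * a + 2)) q N / qpoch (q ^+ (a + 1)) q N)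
     * phi43 (minn i j)
         (q ^ (- i%:Z)) (q ^+ (2 * a + i + 1))
         (q ^ (- j%:Z)) (q ^+ (2 * a + j + 1))
         (q ^+ (a + 1)) (q ^ (- N%:Z)) (q ^+ (3 * a + N + 2)) q q)
  /\
  (let Rq (n x : nat) : R :=
     qRacah n x (q ^+ a) (q ^+ a) (q ^+ (3 * a + N + 1))
       (q ^ (- a%:Z - N%:Z - 1)) q in
   \sum_(0 <= k < N.+1) coef q a N k * Rq i k * Rq j k
   = (-1) ^ (i%:Z + j%:Z - N%:Z)
     * q ^ (('C(i, 2))%:Z + ('C(j, 2))%:Z - ('C(N, 2))%:Z)
     * q ^ ((i%:Z + j%:Z - 2%:Z * N%:Z) * (a%:Z + 1))
     * (qpoch (q ^+ (2 * a + 2)) q N / qpoch (q ^+ (a + 1)) q N)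
     * Rq i j).
Proof.
have q0 : q != 0 by rewrite gt_eqF.
have gen : generic q (q ^+ a).
  by apply: real_generic; rewrite ?exprn_gt0 ?exprn_ile1 ?ltW.
have KT := kernel_twist gen hi hj; rewrite twist_constant // in KT.
split=> [|Rq]; rewrite big_mkord.
- rewrite phi43_kernel // -KT; apply: eq_bigr => k _.
  by rewrite coef_weight // !(@phi43_kernel _ _ _ N) // -ltnS.
- rewrite /Rq qRacah_kernel // -KT; apply: eq_bigr => k _.
  by rewrite coef_weight // !qRacah_kernel // -1?ltnS // [kernel _ _ _ _ (q ^+ j) _]kernelC.
Qed.
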